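(* Let $A\in\mathbb{R}^{n\times n}$ be a real symmetric matrix, let $C\in\mathbb{R}^{n\times r}$ be a column subset of $A$ with $r<n$ and full column rank, and let $C=QR$ be its thin QR factorization. Let $X\in\mathbb{R}^{t\times n}$ be any matrix with orthonormal rows such that $XQ$ has full column rank. Define $$M^*:=\operatorname*{arg\,min}_{M\in\mathbb{R}^{r\times r}}\|A-CMC^{\top}\|_F,\qquad \widehat{M}:=\operatorname*{arg\,min}_{M\in\mathbb{R}^{r\times r}}\|X(A-CMC^{\top})X^{\top}\|_F .$$ Then for every unitarily invariant norm $\|\cdot\|$ on $\mathbb{R}^{n\times n}$, $$\|A-C\widehat{M}C^{\top}\|\le\left(1+\frac{1}{\sigma_{\min}(XQ)^2}\right)\|A-CM^*C^{\top}\|.$$ Furthermore, in the Frobenius norm, $$\|A-C\widehat{M}C^{\top}\|_F\le\left(1+\frac{1}{\sigma_{\min}(XQ)^4}\right)^{1/2}\|A-CM^*C^{\top}\|_F.$$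
   Context: A column subset of $A$ is a matrix $C=A(:,I)\in\mathbb{R}^{n\times r}$ formed by the columns of $A$ indexed by a set $I\subseteq\{1,\dots,n\}$ with $|I|=r$. Thin QR: $Q\in\mathbb{R}^{n\times r}$ has orthonormal columns and $R\in\mathbb{R}^{r\times r}$ is upper triangular. $\sigma_{\min}(XQ)$ is the smallest (i.e. $r$-th largest) singular value of the $t\times r$ matrix $XQ$. $\|\cdot\|_F$ is the Frobenius norm and $\dagger$ denotes the Moore–Penrose pseudoinverse. The minimizers are given by $M^*=C^{\dagger}A(C^{\top})^{\dagger}$ and $\widehat{M}=(XC)^{\dagger}XAX^{\top}((XC)^{\top})^{\dagger}$. *)

(* Defs.v *)
From HB Require Import structures.
From mathcomp Require Import all_boot all_order all_algebra.
From mathcomp Require Import polyrcf reals.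

Set Implicit Arguments.
Unset Strict Implicit.
Unset Printing Implicit Defensive.

Import Order.TTheory GRing.Theory Num.Theory.

Local Open Scope ring_scope.

(* The index set is I = f @: 'I_r; injectivity of f gives #|I| = r, and f fixes
   the (arbitrary) order in which the selected columns are listed. *)
Definition column_subset (R : realType) (n r : nat)
    (A : 'M[R]_n) (C : 'M[R]_(n, r)) : Prop :=
  exists2 f : 'I_r -> 'I_n, injective f & C = colsub f A.

Definition upper_triangular (R : realType) (r : nat) (T : 'M[R]_r) : Prop :=
  forall i j : 'I_r, (j < i)%N -> T i j = 0.

Definition orthonormal_columns (R : realType) (n r : nat)
    (Q : 'M[R]_(n, r)) : Prop := Q^T *m Q = 1%:M.

Definition orthonormal_rows (R : realType) (t n : nat)
    (X : 'M[R]_(t, n)) : Prop := X *m X^T = 1%:M.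

(* No sign normalization is imposed on the diagonal of T. *)
Definition thin_QR (R : realType) (n r : nat)
    (C Q : 'M[R]_(n, r)) (T : 'M[R]_r) : Prop :=
  [/\ orthonormal_columns Q, upper_triangular T & C = Q *m T].

Definition full_column_rank (R : realType) (m n : nat)
    (B : 'M[R]_(m, n)) : Prop := \rank B = n.

Definition frobenius_norm (R : realType) (m n : nat) (B : 'M[R]_(m, n)) : R :=
  Num.sqrt (\sum_i \sum_j B i j ^+ 2).

(* The square roots of the eigenvalues of B^T B, listed with their algebraic
   multiplicities in decreasing order. There are n of them: when m < n the last
   n - m entries are 0. *)
Definition singular_values (R : realType) (m n : nat)
    (B : 'M[R]_(m, n)) : seq R :=
  let p := char_poly (B^T *m B) in
  sort >=%R (flatten [seq nseq (mup x p) (Num.sqrt x) | x <- rootsR p]).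

(* The n-th largest singular value of a matrix with n columns. *)
Definition sigma_min (R : realType) (m n : nat) (B : 'M[R]_(m, n)) : R :=
  (singular_values B)`_n.-1.

Definition is_norm (R : realType) (n : nat) (N : 'M[R]_n -> R) : Prop :=
  [/\ forall B1 B2, N (B1 + B2) <= N B1 + N B2,
      forall (a : R) B, N (a *: B) = `|a| * N B
    & forall B, N B = 0 -> B = 0].

Definition orthogonal_mx (R : realType) (n : nat) (U : 'M[R]_n) : Prop :=
  U^T *m U = 1%:M.

(* Over the reals, the unitary matrices are the orthogonal ones. *)
Definition unitarily_invariant_norm (R : realType) (n : nat)
    (N : 'M[R]_n -> R) : Prop :=
  is_norm N /\
  forall U V B, orthogonal_mx U -> orthogonal_mx V -> N (U *m B *m V) = N B.

Definition is_argmin (R : realType) (T : Type) (f : T -> R) (x : T) : Prop :=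
  forall y, f x <= f y.

(* Main.v *)
Require Import Defs.
From HB Require Import structures.
From mathcomp Require Import all_boot all_order all_algebra.
From mathcomp Require Import polyrcf complex reals ring lra.

(** Write [E = A - C Mstar C^T] and [Y = X Q]. The normal equation of [Mstar] is
    [C^T E C = 0], that is [Q^T E Q = 0], because [T] is invertible. Put
    [C (Mhat - Mstar) C^T = Q Z Q^T]; the normal equation of [Mhat] is then
    [Y^T Y Z Y^T Y = Y^T X E X^T Y], so that [Z = W E W^T], where
    [W = (Y^T Y)^-1 Y^T X] is the pseudoinverse of [Y] times [X]. Hence
    [A - C Mhat C^T = E - K E K^T] with [K = Q W].

    Since [Q] has orthonormal columns and [X] orthonormal rows, [K] has operator
    norm at most [c = 1 / sigma_min Y] ([sketched_projection_svd]). A unitarily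
    invariant norm [N] satisfies [N (K E K^T) <= c^2 N E] ([uinorm_congr]): by the
    singular value decomposition of [K] this reduces to multiplication by a
    diagonal matrix with entries between [-c] and [c] ([uinorm_diag]), which is [c] times
    a convex combination of sign changes. The first bound is then the triangle
    inequality. In the Frobenius norm, [Q^T E Q = 0] makes [E] and [K E K^T]
    orthogonal, and Pythagoras gives the second bound.

    The singular value decomposition of [K] is explicit: it comes from the
    spectral theorem for [Y^T Y] ([real_spectral]) and from completing
    orthonormal frames by reflections ([orthonormal_extension]). The same
    spectral theorem shows that the characteristic polynomial of [Y^T Y] splits
    over the reals, so that for [r > 0] [sigma_min Y] is the square root of its least
    root. *)

Set Implicit Arguments.
Unset Strict Implicit.
Unset Printing Implicit Defensive.

Import Order.TTheory GRing.Theory Num.Theory.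

Local Open Scope ring_scope.

(** * The trace inner product *)

(** The inner product of which [frobenius_norm] is the norm. *)
Definition mxdot (R : comNzRingType) (m n : nat) (A B : 'M[R]_(m, n)) : R :=
  \tr (A^T *m B).

Lemma mxdotC (R : comNzRingType) (m n : nat) (A B : 'M[R]_(m, n)) :
  mxdot A B = mxdot B A.
Proof. by rewrite /mxdot -mxtrace_tr trmx_mul trmxK. Qed.

Lemma mxdotDr (R : comNzRingType) (m n : nat) (A B D : 'M[R]_(m, n)) :
  mxdot A (B + D) = mxdot A B + mxdot A D.
Proof. by rewrite /mxdot mulmxDr linearD. Qed.

Lemma mxdotZr (R : comNzRingType) (m n : nat) a (A B : 'M[R]_(m, n)) :
  mxdot A (a *: B) = a * mxdot A B.
Proof. by rewrite /mxdot -scalemxAr linearZ. Qed.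

Lemma mxdot_add_sqr (R : comNzRingType) (m n : nat) a (A B : 'M[R]_(m, n)) :
  mxdot (A + a *: B) (A + a *: B) =
    mxdot A A + 2 * a * mxdot A B + a ^+ 2 * mxdot B B.
Proof.
rewrite mxdotDr mxdotZr mxdotC mxdotDr mxdotZr.
rewrite [mxdot (A + _) B]mxdotC mxdotDr mxdotZr [mxdot B A]mxdotC; ring.
Qed.

Lemma mxdotE (R : comNzRingType) (m n : nat) (A : 'M[R]_(m, n)) :
  mxdot A A = \sum_i \sum_j A i j ^+ 2.
Proof.
rewrite exchange_big; apply: eq_bigr => j _; rewrite mxE.
by apply: eq_bigr => i _; rewrite mxE expr2.
Qed.

Lemma mxdot_ge0 (R : realDomainType) (m n : nat) (A : 'M[R]_(m, n)) :
  0 <= mxdot A A.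
Proof.
by rewrite mxdotE sumr_ge0 // => i _; rewrite sumr_ge0 // => j _; rewrite sqr_ge0.
Qed.

Lemma mxdot_eq0 (R : realDomainType) (m n : nat) (A : 'M[R]_(m, n)) :
  mxdot A A = 0 -> A = 0.
Proof.
move/eqP; rewrite mxdotE psumr_eq0 => [/allP A0|i _]; last first.
  by rewrite sumr_ge0 // => j _; rewrite sqr_ge0.
apply/matrixP=> i j; rewrite mxE; apply/eqP.
have := A0 i (mem_index_enum i).
rewrite /= psumr_eq0 => [/allP Ai0|k _]; last by rewrite sqr_ge0.
by have := Ai0 j (mem_index_enum j); rewrite /= sqrf_eq0.
Qed.

Lemma mxdot_col (R : comNzRingType) (n : nat) (u v : 'cV[R]_n) :
  u^T *m v = (mxdot u v)%:M.
Proof. by rewrite [LHS]mx11_scalar /mxdot /mxtrace big_ord1. Qed.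

(** * Reflections and orthonormal frames *)

(** The Householder reflection along [f - g] exchanges the unit vectors [f] and
    [g] and fixes every vector (here every column of [B]) orthogonal to
    [f - g]. *)
Lemma reflection (R : realFieldType) (n : nat) (f g : 'cV[R]_n) :
  f^T *m f = 1%:M -> g^T *m g = 1%:M ->
  exists H : 'M[R]_n, [/\ H^T *m H = 1%:M, H *m f = g &
    forall m (B : 'M[R]_(n, m)), f^T *m B = g^T *m B -> H *m B = B].
Proof.
move=> ff gg; have [fg|fg] := eqVneq f g.
  by exists 1%:M; split; rewrite ?trmx1 ?mul1mx // => m B _; rewrite mul1mx.
set w := f - g; pose s := mxdot w w.
have s0 : s != 0.
  by apply: contraNneq fg => /mxdot_eq0/eqP; rewrite subr_eq0.
have ww : w^T *m w = s%:M by rewrite mxdot_col.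
pose H := 1%:M - (2 / s) *: (w *m w^T).
have HT : H^T = H by rewrite /H linearB linearZ /= trmx1 trmx_mul trmxK.
have Hv m (B : 'M_(n, m)) : H *m B = B - (2 / s) *: (w *m (w^T *m B)).
  by rewrite mulmxBl mul1mx -scalemxAl -mulmxA.
exists H; split.
- have wH : w^T *m H = - w^T.
    rewrite mulmxBr mulmx1 -scalemxAr mulmxA ww mul_scalar_mx scalerA divfK//.
    by rewrite scaler_nat mulr2n opprD addrA subrr sub0r.
  by rewrite HT Hv wH mulmxN scalerN opprK subrK.
- rewrite Hv.
  have gf : g^T *m f = f^T *m g.
    by rewrite !mxdot_col mxdotC.
  have swf : s%:M = 2 *: (w^T *m f).
    rewrite -ww /w [(f - g)^T]linearB /= !(mulmxBl, mulmxBr) ff gg gf.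
    by rewrite scaler_nat mulr2n opprB.
  have -> : w^T *m f = (s / 2)%:M.
    have half2 : 2^-1 * 2 = 1 :> R by rewrite mulVf ?pnatr_eq0.
    by rewrite -[LHS]scale1r -[in LHS]half2 -scalerA -swf scale_scalar_mx mulrC.
  rewrite mul_mx_scalar scalerA mulrA divfK // divff ?pnatr_eq0// scale1r.
  by rewrite /w opprB addrC subrK.
- move=> m B fB; have wB : w^T *m B = 0.
    by rewrite /w linearB /= mulmxBl fB subrr.
  by rewrite Hv wB mulmx0 scaler0 subr0.
Qed.

(** Some orthogonal matrix carries any orthonormal frame to any other one of the
    same size: once the last vectors agree, reflect the images of the first
    vectors onto each other. *)
Lemma orthonormal_extension (R : realFieldType) (n r : nat)
    (F G : 'M[R]_(n, r)) :
  F^T *m F = 1%:M -> G^T *m G = 1%:M ->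
  exists O : 'M[R]_n, O^T *m O = 1%:M /\ O *m F = G.
Proof.
elim: r F G => [|r IHr] F G; [move=> _ _|].
  exists 1%:M; rewrite trmx1 mul1mx; split=> //.
  by rewrite [LHS]thinmx0 [RHS]thinmx0.
rewrite -[r.+1]/(1 + r)%N in F G *; move=> FF GG.
have split1 (M : 'M[R]_(n, 1 + r)) : M^T *m M = 1%:M ->
    [/\ (lsubmx M)^T *m lsubmx M = 1%:M, (lsubmx M)^T *m rsubmx M = 0 &
        (rsubmx M)^T *m rsubmx M = 1%:M].
  rewrite -[M]hsubmxK tr_row_mx mul_col_row scalar_mx_block.
  by case/eq_block_mx; rewrite row_mxKl row_mxKr.
have [ff fF FF'] := split1 _ FF; have [gg gG GG'] := split1 _ GG.
have [O [OO OF]] := IHr _ _ FF' GG'.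
have Off : (O *m lsubmx F)^T *m (O *m lsubmx F) = 1%:M.
  by rewrite trmx_mul mulmxA -[_ *m _ *m O]mulmxA OO mulmx1.
have [H [HH Hf HG]] := reflection Off gg.
exists (H *m O); split.
  by rewrite trmx_mul mulmxA -[_ *m _ *m H]mulmxA HH mulmx1.
have HG' : H *m rsubmx G = rsubmx G.
  apply: HG; rewrite gG -OF trmx_mul.
  by rewrite mulmxA -[_ *m _ *m O]mulmxA OO mulmx1.
by rewrite -[F]hsubmxK mul_mx_row -!mulmxA Hf OF HG' hsubmxK.
Qed.

(** * The real spectral theorem *)

(** Over [R[i]] the matrix is hermitian, hence unitarily diagonalizable with a
    real diagonal; a diagonal entry is a root of the real characteristic
    polynomial. *)
Lemma symmetric_eigenvalue (R : rcfType) (n : nat) (G : 'M[R]_n.+1) :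
  G^T = G -> exists a, eigenvalue G a.
Proof.
move=> GT; pose Gc : 'M[R[i]]_n.+1 := map_mx (real_complex R) G.
have Gc_herm : Gc \is hermsymmx.
  apply: realsym_hermsym; last first.
    by apply/mxOverP=> i j; rewrite mxE complex_real.
  by apply/is_hermitianmxP; rewrite expr0 scale1r map_mx_id // map_trmx GT.
have /hermitian_normalmx/orthomx_spectralP Gc_spec := Gc_herm.
have /mxOverP/(_ 0 0) := hermitian_spectral_diag_real Gc_herm.
set P := spectralmx Gc in Gc_spec; have Punit : P \in unitmx := spectral_unit Gc.
case/complex_realP=> a aE; exists a.
rewrite eigenvalue_root_char -(fmorph_root (real_complex R)).
rewrite map_char_poly -eigenvalue_root_char; apply/eigenvalueP; exists (row 0 P).
  have PG : P *m Gc = diag_mx (spectral_diag Gc) *m P.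
    by rewrite [in LHS]Gc_spec !mulmxA mulmxV // mul1mx.
  rewrite -/Gc -row_mul PG row_mul row_diag_mx aE -scalemxAl.
  by rewrite [in RHS]rowE.
apply: contraTneq Punit => P0; rewrite -row_free_unit.
apply/negP=> /row_freeP[B /(congr1 (row 0))].
by rewrite row_mul P0 mul0mx => /rowP/(_ 0)/eqP; rewrite !mxE eqxx eq_sym oner_eq0.
Qed.

(** By induction on the size: rotate the first basis vector onto a unit
    eigenvector; the matrix becomes block diagonal by symmetry. *)
Lemma real_spectral (R : rcfType) (n : nat) (G : 'M[R]_n) :
  G^T = G ->
  exists (U : 'M[R]_n) (d : 'rV[R]_n),
    U^T *m U = 1%:M /\ G = U^T *m diag_mx d *m U.
Proof.
elim: n G => [|n IHn] G GT.
  exists 1%:M, 0; rewrite trmx1 mul1mx; split=> //.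
  by rewrite [LHS]thinmx0 [RHS]thinmx0.
have [a /eigenvalueP[v vG v0]] := symmetric_eigenvalue GT.
rewrite -[n.+1]/(1 + n)%N in G GT v vG v0 *.
pose c := mxdot v^T v^T.
have c0 : 0 < c.
  rewrite lt0r mxdot_ge0 andbT; apply: contraNneq v0 => /mxdot_eq0 v0.
  by rewrite -[v]trmxK v0 trmx0.
pose f := (Num.sqrt c)^-1 *: v^T.
have ff : f^T *m f = 1%:M.
  rewrite mxdot_col mxdotZr mxdotC mxdotZr -/c mulrA -invfM -expr2.
  by rewrite sqr_sqrtr ?ltW // mulVf // lt0r_neq0.
have Gf : G *m f = a *: f.
  by rewrite /f -scalemxAr -[G]GT -trmx_mul vG linearZ /= scalerA mulrC scalerA.
pose e : 'cV[R]_(1 + n) := col_mx 1%:M 0.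
have ee : e^T *m e = 1%:M.
  by rewrite tr_col_mx mul_row_col trmx1 mulmx1 trmx0 mul0mx addr0.
have [O [OO Oe]] := orthonormal_extension ee ff.
pose H := O^T *m G *m O.
have HT : H^T = H by rewrite !trmx_mul trmxK GT mulmxA.
have He : H *m e = a *: e.
  by rewrite -!mulmxA Oe Gf -scalemxAr -Oe mulmxA OO mul1mx.
have [G' G'T HE] : exists2 G' : 'M[R]_n, G'^T = G' & H = block_mx a%:M 0 0 G'.
  exists (drsubmx H); first by rewrite trmx_drsub HT.
  have : lsubmx H = a *: e.
    by rewrite -He -[H in RHS]hsubmxK mul_row_col mulmx1 mulmx0 addr0.
  rewrite -[H in lsubmx H]submxK block_mxEh row_mxKl scale_col_mx scaler0 scalemx1.
  case/eq_col_mx => ul dl; rewrite -[LHS]submxK ul dl; congr block_mx.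
  by rewrite -[H]HT -trmx_dlsub dl trmx0.
have [U [d [UU G'E]]] := IHn G' G'T.
exists (block_mx 1%:M 0 0 U *m O^T), (row_mx a%:M d).
have OO' : O *m O^T = 1%:M by apply: mulmx1C.
have BB : (block_mx 1%:M 0 0 U)^T *m block_mx 1%:M 0 0 U = 1%:M :> 'M[R]_(1 + n).
  rewrite tr_block_mx mulmx_block !trmx0 !mulmx0 !mul0mx UU !addr0 !add0r.
  by rewrite trmx1 mulmx1 -scalar_mx_block.
split.
  by rewrite trmx_mul trmxK mulmxA -[_ *m _ *m block_mx _ _ _ _]mulmxA BB mulmx1.
have -> : G = O *m block_mx a%:M 0 0 G' *m O^T.
  by rewrite -HE /H !mulmxA OO' mul1mx -mulmxA OO' mulmx1.
rewrite trmx_mul trmxK -!mulmxA; congr (O *m _); rewrite !mulmxA; congr (_ *m O^T).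
rewrite diag_mx_row !tr_block_mx !mulmx_block.
rewrite !trmx0 !mulmx0 !mul0mx !addr0 !add0r trmx1 mulmx1 mul1mx G'E.
congr block_mx; rewrite ?mul0mx ?mulmx0 //.
by apply/matrixP=> i j; rewrite !ord1 !mxE eqxx.
Qed.

(** * The smallest singular value *)

Lemma char_poly_orthogonal_diag (R : comNzRingType) (n : nat) (U : 'M[R]_n)
    (d : 'rV[R]_n) :
  U^T *m U = 1%:M ->
  char_poly (U^T *m diag_mx d *m U) = \prod_(i < n) ('X - (d 0 i)%:P).
Proof.
move=> UU; have UU' : U *m U^T = 1%:M by apply: mulmx1C.
have -> : \prod_(i < n) ('X - (d 0 i)%:P) = char_poly (diag_mx d).
  rewrite char_poly_trig ?diag_mx_is_trig //.
  by apply: eq_bigr => i _; rewrite mxE eqxx.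
pose V := map_mx (@polyC R) U.
have VV : V^T *m V = 1%:M by rewrite /V map_trmx -map_mxM UU map_mx1.
have -> : char_poly (U^T *m diag_mx d *m U) =
    \det (V^T *m char_poly_mx (diag_mx d) *m V).
  rewrite /char_poly /char_poly_mx !map_mxM /= mulmxBr mulmxBl; congr (\det (_ - _)).
  - by rewrite scalar_mxC -mulmxA VV mulmx1.
  - by rewrite /V map_trmx.
by rewrite !det_mulmx mulrAC -det_mulmx VV det1 mul1r.
Qed.

Section SigmaMin.
Variables (R : realType) (m n : nat) (B : 'M[R]_(m, n)).
Variables (U : 'M[R]_n) (d : 'rV[R]_n).
Hypotheses (UU : U^T *m U = 1%:M) (BE : B^T *m B = U^T *m diag_mx d *m U).

(* The eigenvalues of the Gram matrix, with multiplicity. *)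
Let s := [seq d 0 i | i <- enum 'I_n].

Lemma gram_char_poly : char_poly (B^T *m B) = \prod_(x <- s) ('X - x%:P).
Proof.
rewrite BE char_poly_orthogonal_diag // big_map big_enum /=.
by apply: eq_bigl => i; rewrite inE.
Qed.

(** The spectral theorem makes the real roots of the characteristic polynomial,
    counted with multiplicity, exhaust [s]; no entry of [singular_values] is
    missing. *)
Lemma singular_values_perm :
  perm_eq (singular_values B) [seq Num.sqrt x | x <- s].
Proof.
rewrite /singular_values perm_sort gram_char_poly.
set p := \prod_(x <- s) _.
have p0 : p != 0 by rewrite /p -gram_char_poly monic_neq0 // char_poly_monic.
have rootE x : (x \in rootsR p) = (x \in s).
  by rewrite -(roots_on_rootsR p0) inE /= root_prod_XsubC.
have -> : flatten [seq nseq (mup x p) (Num.sqrt x) | x <- rootsR p] =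
    map Num.sqrt (flatten [seq nseq (mup x p) x | x <- rootsR p]).
  rewrite map_flatten -map_comp; congr flatten; apply: eq_map => x /=.
  by rewrite map_nseq.
apply: perm_map; apply/allP => x _ /=; apply/eqP.
rewrite count_flatten -map_comp sumnE big_map /=.
have roots_uniq : uniq (rootsR p) by apply: uniq_roots.
rewrite (eq_bigr (fun y => if y == x then mup x p else 0%N)); last first.
  by move=> y _; rewrite /= count_nseq /=; case: eqP => [->|]; rewrite ?mul1n.
rewrite -big_mkcond /=.
have [xs|xs] := boolP (x \in s).
  rewrite -big_filter filter_pred1_uniq ?rootE // big_seq1.
  by rewrite mu_prod_XsubC.
rewrite big1_seq; last by move=> y /andP[/eqP-> ]; rewrite rootE (negPf xs).
by apply/esym/count_memPn.
Qed.

Lemma size_singular_values : size (singular_values B) = n.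
Proof.
by rewrite (perm_size singular_values_perm) /s 2!size_map size_enum_ord.
Qed.

Lemma sigma_min_le (i : 'I_n) : sigma_min B <= Num.sqrt (d 0 i).
Proof.
have di : Num.sqrt (d 0 i) \in singular_values B.
  by rewrite (perm_mem singular_values_perm) !map_f // mem_enum.
have sv_sorted : sorted >=%R (singular_values B) by apply/sort_sorted/ge_total.
have [k] := nthP 0 di; rewrite size_singular_values => lt_kn <-.
apply: (sorted_leq_nth ge_trans ge_refl 0 sv_sorted); rewrite ?inE.
- by rewrite size_singular_values.
- by rewrite size_singular_values; case: (n) lt_kn.
- by case: (n) lt_kn.
Qed.

Lemma sigma_min_attained :
  (0 < n)%N -> exists i, sigma_min B = Num.sqrt (d 0 i).
Proof.
move=> n0; have : sigma_min B \in singular_values B.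
  by rewrite mem_nth // size_singular_values ltn_predL.
by rewrite (perm_mem singular_values_perm) => /mapP[_ /mapP[i _ ->] ->]; exists i.
Qed.

End SigmaMin.

Lemma sigma_min_ge0 (R : realType) (m n : nat) (B : 'M[R]_(m, n)) :
  0 <= sigma_min B.
Proof.
rewrite /sigma_min.
have [lt_n|le_n] := ltnP n.-1 (size (singular_values B)); last first.
  by rewrite nth_default.
have := mem_nth 0 lt_n; rewrite [X in _ \in X]/singular_values mem_sort.
case/flattenP=> _ /mapP[x _ ->]; rewrite mem_nseq => /andP[_ /eqP->].
exact: sqrtr_ge0.
Qed.

(** When [n] is zero the bound on [sigma_min] is vacuous, and [1 / sigma_min B] is
    zero by the convention on inverses. *)
Lemma gram_spectral (R : realType) (m n : nat) (B : 'M[R]_(m, n)) :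
  full_column_rank B ->
  exists (U : 'M[R]_n) (d : 'rV[R]_n),
    [/\ U^T *m U = 1%:M, B^T *m B = U^T *m diag_mx d *m U, forall i, 0 < d 0 i &
        forall i, (Num.sqrt (d 0 i))^-1 <= 1 / sigma_min B].
Proof.
move=> B_rank.
have [|U [d [UU BE]]] := @real_spectral _ _ (B^T *m B).
  by rewrite trmx_mul trmxK.
have d_gt0 i : 0 < d 0 i.
  have UU' : U *m U^T = 1%:M by apply: mulmx1C.
  (* [d 0 i] is the squared norm of the image of the [i]-th eigenvector. *)
  pose u : 'cV[R]_n := U^T *m delta_mx i 0.
  have dE : d 0 i = mxdot (B *m u) (B *m u).
    rewrite /mxdot trmx_mul !mulmxA -[_ *m B^T *m B]mulmxA BE /u trmx_mul trmxK.
    rewrite !mulmxA -[_ *m U *m U^T]mulmxA UU' mulmx1.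
    rewrite -[_ *m U *m U^T]mulmxA UU' mulmx1 trmx_delta -rowE -colE.
    by rewrite /mxtrace big_ord1 !mxE eqxx.
  rewrite lt0r {2}dE mxdot_ge0 andbT dE; apply/eqP => /mxdot_eq0 Bu.
  have BT_free : row_free B^T by rewrite /row_free mxrank_tr B_rank.
  have /eqP : u^T *m B^T = 0 by rewrite -trmx_mul Bu trmx0.
  rewrite mulmx_free_eq0 // => /eqP/(congr1 trmx); rewrite trmxK trmx0 => u0.
  have /matrixP/(_ i 0) : delta_mx i 0 = 0 :> 'cV[R]_n.
    by rewrite -[LHS]mul1mx -UU' -mulmxA -/u u0 mulmx0.
  by rewrite !mxE !eqxx => /eqP; rewrite oner_eq0.
exists U, d; split=> // i; rewrite div1r lef_pV2 ?posrE ?sqrtr_gt0 //.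
  exact: sigma_min_le UU BE i.
have n0 : (0 < n)%N by apply: leq_ltn_trans (ltn_ord i).
by have [j ->] := sigma_min_attained UU BE n0; rewrite sqrtr_gt0.
Qed.

(** * Unitarily invariant norms *)

Lemma norm_mx0 (R : realType) (n : nat) (N : 'M[R]_n -> R) :
  is_norm N -> N 0 = 0.
Proof. by case=> _ NZ _; rewrite -(scale0r 0) NZ normr0 mul0r. Qed.

(** The identity matrix with its [i]-th diagonal entry replaced by [x]. *)
Definition coord_mx (R : nzRingType) (n : nat) (i : 'I_n) (x : R) : 'M[R]_n :=
  diag_mx (\row_j if j == i then x else 1).

(** For [x] between -1 and 1, [coord_mx i x] is a convex combination of the identity
    and of the orthogonal sign change [coord_mx i (-1)]. *)
Lemma uinorm_coord (R : realType) (n : nat) (N : 'M[R]_n -> R) i x B :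
  unitarily_invariant_norm N -> `|x| <= 1 -> N (coord_mx i x *m B) <= N B.
Proof.
move=> [[ND NZ _] NU] x1.
have -> : coord_mx i x *m B =
    ((1 + x) / 2) *: B + ((1 - x) / 2) *: (coord_mx i (-1) *m B).
  apply/matrixP=> j k; rewrite !mul_diag_mx !mxE.
  by case: eqP => _; field.
apply: le_trans (ND _ _) _; rewrite !NZ.
have -> : N (coord_mx i (-1) *m B) = N B.
  rewrite -[coord_mx i (-1) *m B]mulmx1 NU //; last first.
    by rewrite /orthogonal_mx trmx1 mulmx1.
  rewrite /orthogonal_mx tr_diag_mx mulmx_diag -diag_const_mx; congr diag_mx.
  by apply/rowP=> j; rewrite !mxE; case: eqP => _; rewrite ?mulrNN mulr1.
have /andP[xl xr] : -1 <= x <= 1 by rewrite -ler_norml.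
by rewrite !ger0_norm; [lra | lra | lra].
Qed.

Lemma uinorm_diag (R : realType) (n : nat) (N : 'M[R]_n -> R) c (d : 'rV_n) B :
  unitarily_invariant_norm N -> 0 <= c -> (forall i, `|d 0 i| <= c) ->
  N (diag_mx d *m B) <= c * N B.
Proof.
move=> Nui c0 dc; have [NN _] := Nui.
have unit_case (e : 'rV_n) : (forall i, `|e 0 i| <= 1) ->
    N (diag_mx e *m B) <= N B.
  (* Insert the diagonal entries of [e] one coordinate at a time. *)
  move=> e1; pose es (s : seq 'I_n) := \row_i (if i \in s then e 0 i else 1).
  have -> : e = es (enum 'I_n) by apply/rowP=> i; rewrite mxE mem_enum.
  elim: (enum 'I_n) => [|i s IHs].
    have -> : es [::] = const_mx 1 by apply/rowP=> i; rewrite !mxE.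
    by rewrite diag_const_mx mul1mx.
  have [si|si] := boolP (i \in s).
    have -> // : es (i :: s) = es s.
    by apply/rowP=> j; rewrite !mxE inE; case: eqP => // ->; rewrite si.
  have -> : diag_mx (es (i :: s)) = coord_mx i (e 0 i) *m diag_mx (es s).
    rewrite mulmx_diag; congr diag_mx; apply/rowP=> j; rewrite !mxE inE.
    by case: eqP => [->|_]; rewrite ?(negPf si) ?mulr1 ?mul1r.
  by rewrite -mulmxA; apply: le_trans IHs; apply: uinorm_coord.
have [c_eq0|c_neq0] := eqVneq c 0.
  have -> : d = 0.
    by apply/rowP=> i; apply/eqP; rewrite mxE -normr_le0 -c_eq0 dc.
  by rewrite linear0 mul0mx norm_mx0 // c_eq0 mul0r.
have {c_neq0}c_gt0 : 0 < c by rewrite lt0r c_neq0.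
have -> : diag_mx d *m B = c *: (diag_mx (c^-1 *: d) *m B).
  by rewrite linearZ /= -scalemxAl scalerA divff ?scale1r // lt0r_neq0.
have [_ -> _] := NN; rewrite ger0_norm // ler_wpM2l // unit_case // => i.
by rewrite mxE normrM normfV (ger0_norm c0) ler_pdivrMl ?mulr1.
Qed.

(** Completing the frames [Q] and [V^T] turns a thin singular value decomposition
    into a square one, with [n - r] additional zeros on the diagonal. *)
Lemma frame_svd (R : realType) (n r : nat) (c : R)
    (Q : 'M[R]_(n, r)) (e : 'rV[R]_r) (V : 'M[R]_(r, n)) :
  Q^T *m Q = 1%:M -> V *m V^T = 1%:M -> 0 <= c -> (forall i, `|e 0 i| <= c) ->
  exists (O1 O2 : 'M[R]_n) (d : 'rV[R]_n),
    [/\ orthogonal_mx O1, orthogonal_mx O2, forall i, `|d 0 i| <= c &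
        Q *m diag_mx e *m V = O1 *m diag_mx d *m O2].
Proof.
move=> QQ VV c0 ec.
have le_rn : (r <= n)%N.
  rewrite -(mxrank1 R r) -VV; apply: leq_trans (mxrankM_maxr _ _) _.
  by rewrite rank_leq_row.
pose J : 'M[R]_(n, r) := pid_mx r.
have JJ : J^T *m J = 1%:M by rewrite tr_pid_mx pid_mx_id // pid_mx_1.
have VV' : V^T^T *m V^T = 1%:M by rewrite trmxK.
have [O1 [O1O JQ]] := orthonormal_extension JJ QQ.
have [O2 [O2O JV]] := orthonormal_extension JJ VV'.
pose d := \row_(i < n) if insub (val i) is Some k then e 0 k else 0.
exists O1, O2^T, d; split=> //.
- by rewrite /orthogonal_mx trmxK; apply: mulmx1C.
- by move=> i; rewrite mxE; case: insubP => [k _ _|_]; rewrite ?normr0.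
have -> : V = J^T *m O2^T by rewrite -trmx_mul JV trmxK.
rewrite -JQ -!mulmxA; congr (O1 *m _); rewrite !mulmxA; congr (_ *m O2^T).
rewrite mul_mx_diag; apply/matrixP=> i j; rewrite !mxE.
case: insubP => [k lt_ir ki|].
  rewrite (bigD1 k) //= big1 => [|l lk]; rewrite !mxE -ki ?eqxx ?ltn_ord /=.
    rewrite addr0 mul1r eq_sym ki; have [<-|ij] := eqVneq i j.
      by rewrite eqxx lt_ir mulr1.
    by rewrite val_eqE (negPf ij) mulr0.
  have -> : (k == l :> nat) = false by rewrite eq_sym; apply: negPf.
  by rewrite !mul0r.
rewrite -leqNgt => le_ri; rewrite mul0rn big1 // => k _.
by rewrite !mxE [(i < r)%N]ltnNge le_ri andbF !mul0r.
Qed.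

Lemma uinorm_tr (R : realType) (n : nat) (N : 'M[R]_n -> R) :
  unitarily_invariant_norm N -> unitarily_invariant_norm (fun B => N B^T).
Proof.
have orthT (U : 'M[R]_n) : orthogonal_mx U -> orthogonal_mx U^T.
  by rewrite /orthogonal_mx trmxK; apply: mulmx1C.
move=> [[ND NZ N0] NU]; split; first split.
- by move=> B1 B2; rewrite linearD /=.
- by move=> a B; rewrite linearZ /=.
- by move=> B /N0/(congr1 trmx); rewrite trmxK trmx0.
- by move=> U V B UU VV; rewrite !trmx_mul mulmxA NU //; apply: orthT.
Qed.

(** The hypotheses on [K] say that its operator norm is at most [c]. *)
Lemma uinorm_congr (R : realType) (n : nat) (N : 'M[R]_n -> R) c
    (K O1 O2 : 'M[R]_n) (d : 'rV[R]_n) B :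
  unitarily_invariant_norm N ->
  orthogonal_mx O1 -> orthogonal_mx O2 -> 0 <= c -> (forall i, `|d 0 i| <= c) ->
  K = O1 *m diag_mx d *m O2 ->
  N (K *m B *m K^T) <= c ^+ 2 * N B.
Proof.
move=> Nui O1O O2O c0 dc KE.
have mulK N' B' : unitarily_invariant_norm N' -> N' (K *m B') <= c * N' B'.
  move=> N'ui; have [_ N'U] := N'ui.
  have id_orth : orthogonal_mx (1%:M : 'M[R]_n).
    by rewrite /orthogonal_mx trmx1 mulmx1.
  have -> : N' (K *m B') = N' (diag_mx d *m (O2 *m B')).
    by rewrite KE -!mulmxA -[_ *m (_ *m (_ *m _))]mulmx1 N'U.
  apply: le_trans (uinorm_diag _ N'ui c0 dc) _.
  by rewrite -[O2 *m B']mulmx1 N'U.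
have -> : N (K *m B *m K^T) = N (K *m (K *m B)^T)^T.
  by rewrite [in RHS]trmx_mul trmxK.
apply: le_trans (mulK _ _ (uinorm_tr Nui)) _.
by rewrite trmxK expr2 -mulrA ler_wpM2l // mulK.
Qed.

(** * The Frobenius norm *)

Lemma frobenius_normE (R : realType) (m n : nat) (A : 'M[R]_(m, n)) :
  frobenius_norm A = Num.sqrt (mxdot A A).
Proof. by rewrite mxdotE. Qed.

Lemma mxdot_CauchySchwarz (R : realType) (m n : nat) (A B : 'M[R]_(m, n)) :
  mxdot A B <= frobenius_norm A * frobenius_norm B.
Proof.
rewrite !frobenius_normE -sqrtrM ?mxdot_ge0 //.
apply: le_trans (ler_norm _) _; rewrite -sqrtr_sqr ler_sqrt ?mulr_ge0 ?mxdot_ge0 //.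
have [B0|B0] := eqVneq (mxdot B B) 0.
  have -> : B = 0 by apply: mxdot_eq0.
  by rewrite -(scale0r 0) !mxdotZr !mul0r mulr0 expr0n.
have B_gt0 : 0 < mxdot B B by rewrite lt0r B0 mxdot_ge0.
(* The residual of the projection of [A] on the line spanned by [B]. *)
have := mxdot_ge0 (A + (- mxdot A B / mxdot B B) *: B).
rewrite mxdot_add_sqr => h.
have -> : mxdot A B ^+ 2 = (mxdot A B ^+ 2 / mxdot B B) * mxdot B B by field.
rewrite (ler_wpM2r (ltW B_gt0)) // -subr_ge0; apply: le_trans h _.
by rewrite le_eqVlt; apply/orP; left; apply/eqP; field.
Qed.

Lemma frobenius_uinorm (R : realType) (n : nat) :
  unitarily_invariant_norm (@frobenius_norm R n n).
Proof.
split; first split.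
- move=> A B.
  rewrite -(@ler_pXn2r _ 2) // ?nnegrE ?addr_ge0 ?sqrtr_ge0 //.
  have frob2 D : frobenius_norm D ^+ 2 = mxdot D D.
    by rewrite frobenius_normE sqr_sqrtr // mxdot_ge0.
  rewrite sqrrD !frob2 -{1 2}[B]scale1r mxdot_add_sqr.
  by have := mxdot_CauchySchwarz A B; rewrite -mulr_natl; lra.
- move=> a B; rewrite !frobenius_normE mxdotZr mxdotC mxdotZr mulrA -expr2.
  by rewrite sqrtrM ?sqr_ge0 // sqrtr_sqr.
- move=> B; rewrite frobenius_normE => /eqP; rewrite sqrtr_eq0 => B0.
  by apply: mxdot_eq0; apply/eqP; rewrite eq_le B0 mxdot_ge0.
- move=> U V B UU VV; rewrite !frobenius_normE; congr Num.sqrt.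
  have VV' : V *m V^T = 1%:M by apply: mulmx1C.
  rewrite /mxdot !trmx_mul -!mulmxA [U^T *m _]mulmxA UU mul1mx.
  by rewrite mxtrace_mulC -!mulmxA VV' mulmx1.
Qed.

(** The residual of a minimizer is orthogonal to every [L *m D *m L^T]; taking for
    [D] the left-hand side itself gives the normal equation. *)
Lemma argmin_normal_eq (R : realType) (m r : nat) (B : 'M[R]_m)
    (L : 'M[R]_(m, r)) (M : 'M[R]_r) :
  is_argmin (fun M => frobenius_norm (B - L *m M *m L^T)) M ->
  L^T *m (B - L *m M *m L^T) *m L = 0.
Proof.
move=> Mmin; set S := B - _; set D := L^T *m S *m L.
pose P := L *m D *m L^T.
have SP : mxdot S P = mxdot D D.
  rewrite /mxdot {1}/D !trmx_mul trmxK /P -!mulmxA.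
  by rewrite !mulmxA mxtrace_mulC !mulmxA.
apply/mxdot_eq0/eqP; rewrite eq_le mxdot_ge0 andbT leNgt; apply/negP=> D_gt0.
set a := mxdot D D in SP D_gt0; set b := mxdot P P.
have b_ge0 : 0 <= b := mxdot_ge0 P.
have b1 : 0 < b + 1 by lra.
(* Any step below [2 * a / b] decreases the objective; [a / (b + 1)] avoids
   dividing by [b], which could be zero. *)
have := Mmin (M + (a / (b + 1)) *: D).
have -> : B - L *m (M + (a / (b + 1)) *: D) *m L^T = S + (- (a / (b + 1))) *: P.
  by rewrite mulmxDr mulmxDl -scalemxAr -scalemxAl scaleNr opprD addrA.
rewrite -/S !frobenius_normE ler_sqrt ?mxdot_ge0 // mxdot_add_sqr SP -/b.
rewrite -[X in X <= _]addr0 -addrA lerD2l.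
have -> : 2 * - (a / (b + 1)) * a + (- (a / (b + 1))) ^+ 2 * b =
    - ((a / (b + 1)) ^+ 2 * (b + 2)) by field; rewrite gt_eqF.
rewrite oppr_ge0; apply/negP; rewrite -ltNge.
by rewrite mulr_gt0 ?exprn_gt0 ?divr_gt0 //; lra.
Qed.

(** * The sketched approximation *)

(** [invmx (Y^T *m Y) *m Y^T] is the pseudoinverse of [Y]. If
    [Y^T *m Y = U^T *m D^-2 *m U], then the product with [Q] and [X] has the thin
    singular value decomposition with left frame [Q *m U^T], diagonal [D] and
    right frame [V = D *m U *m Y^T *m X]. *)
Lemma sketched_projection_svd (R : realType) (n r t : nat) (Q : 'M[R]_(n, r))
    (X : 'M[R]_(t, n)) (Y : 'M[R]_(t, r)) :
  orthonormal_columns Q -> orthonormal_rows X -> full_column_rank Y ->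
  Y^T *m Y \in unitmx /\
  exists (O1 O2 : 'M[R]_n) (d : 'rV[R]_n),
    [/\ orthogonal_mx O1, orthogonal_mx O2, forall i, `|d 0 i| <= 1 / sigma_min Y &
        Q *m (invmx (Y^T *m Y) *m Y^T *m X) = O1 *m diag_mx d *m O2].
Proof.
move=> QQ XX Y_rank; have [U [d [UU GE d_gt0 dc]]] := gram_spectral Y_rank.
have UU' : U *m U^T = 1%:M by apply: mulmx1C.
set G := Y^T *m Y in GE *.
pose e := \row_i (Num.sqrt (d 0 i))^-1; pose D := diag_mx e.
have eed : D *m D *m diag_mx d = 1%:M.
  rewrite !mulmx_diag -diag_const_mx; congr diag_mx.
  apply/rowP=> i; rewrite !mxE -invfM -expr2 sqr_sqrtr ?ltW // mulVf //.
  exact: lt0r_neq0.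
have GiG : U^T *m D *m D *m U *m G = 1%:M.
  rewrite GE !mulmxA -[_ *m U *m U^T]mulmxA UU' mulmx1.
  by rewrite -[_ *m D *m D]mulmxA -[_ *m _ *m diag_mx d]mulmxA eed mulmx1.
have [_ Gu] := mulmx1_unit GiG.
have GiE : invmx G = U^T *m D *m D *m U.
  by rewrite -[RHS]mulmx1 -(mulmxV Gu) mulmxA GiG mul1mx.
pose V := D *m U *m Y^T *m X.
have Q1 : (Q *m U^T)^T *m (Q *m U^T) = 1%:M.
  by rewrite trmx_mul trmxK mulmxA -[U *m _ *m Q]mulmxA QQ mulmx1.
have DT : D^T = D by rewrite tr_diag_mx.
have VV : V *m V^T = 1%:M.
  rewrite /V !trmx_mul trmxK !mulmxA DT -[_ *m X *m X^T]mulmxA XX mulmx1.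
  rewrite -[_ *m Y^T *m Y]mulmxA -/G GE !mulmxA -[_ *m U *m U^T]mulmxA UU' mulmx1.
  rewrite -[_ *m U *m U^T]mulmxA UU' mulmx1 /D !mulmx_diag.
  rewrite -[RHS]eed !mulmx_diag; congr diag_mx.
  by apply/rowP=> i; rewrite !mxE; ring.
have c0 : 0 <= 1 / sigma_min Y by rewrite div1r invr_ge0 sigma_min_ge0.
have ec i : `|e 0 i| <= 1 / sigma_min Y.
  by rewrite mxE ger0_norm // invr_ge0 sqrtr_ge0.
have [O1 [O2 [d' [O1O O2O d'c KE]]]] := frame_svd Q1 VV c0 ec.
split=> //; exists O1, O2, d'; split=> //.
by rewrite -KE GiE /V !mulmxA.
Qed.

Lemma congr_unit_eq0 (R : comUnitRingType) (r : nat) (T S : 'M[R]_r) :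
  T \in unitmx -> T^T *m S *m T = 0 -> S = 0.
Proof.
move=> Tu TST; have TTu : T^T \in unitmx by rewrite unitmx_tr.
by rewrite -[S](mulKmx TTu) -[X in invmx _ *m X](mulmxK Tu) TST mul0mx mulmx0.
Qed.

Theorem theorem4p1 (R : realType) (n r t : nat)
    (A : 'M[R]_n) (C Q : 'M[R]_(n, r)) (T : 'M[R]_r) (X : 'M[R]_(t, n))
    (Mstar Mhat : 'M[R]_r)
    (A_sym : A^T = A)
    (C_sub : column_subset A C)
    (lt_rn : (r < n)%N)
    (C_rank : full_column_rank C)
    (C_QR : thin_QR C Q T)
    (X_orth : orthonormal_rows X)
    (XQ_rank : full_column_rank (X *m Q))
    (Mstar_min :
      is_argmin (fun M : 'M[R]_r => frobenius_norm (A - C *m M *m C^T)) Mstar)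
    (Mhat_min :
      is_argmin (fun M : 'M[R]_r =>
        frobenius_norm (X *m (A - C *m M *m C^T) *m X^T)) Mhat) :
  (forall N : 'M[R]_n -> R, unitarily_invariant_norm N ->
     N (A - C *m Mhat *m C^T)
       <= (1 + 1 / sigma_min (X *m Q) ^+ 2) * N (A - C *m Mstar *m C^T)) /\
  frobenius_norm (A - C *m Mhat *m C^T)
    <= Num.sqrt (1 + 1 / sigma_min (X *m Q) ^+ 4)
       * frobenius_norm (A - C *m Mstar *m C^T).
Proof.
have [QQ _ CE] := C_QR; set E := A - C *m Mstar *m C^T.
have Tu : T \in unitmx.
  rewrite -row_free_unit /row_free eqn_leq rank_leq_row /=.
  by rewrite -[X in (X <= _)%N]C_rank CE mxrankM_maxr.
have EQ : Q^T *m E *m Q = 0.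
  have := argmin_normal_eq Mstar_min.
  rewrite -/E CE trmx_mul => CEC.
  by apply: (congr_unit_eq0 Tu); rewrite -[RHS]CEC !mulmxA.
have [Y YE] : {Y | X *m Q = Y} by exists (X *m Q).
rewrite YE in XQ_rank *.
have [Gu [O1 [O2 [d [O1O O2O dc KE]]]]] :=
  sketched_projection_svd QQ X_orth XQ_rank.
have [W WE] : {W | W = invmx (Y^T *m Y) *m Y^T *m X}.
  by exists (invmx (Y^T *m Y) *m Y^T *m X).
rewrite -WE in KE.
pose Z := T *m (Mhat - Mstar) *m T^T.
have hatE : A - C *m Mhat *m C^T = E - Q *m Z *m Q^T.
  rewrite /E /Z -[A - C *m Mstar *m _ - _]addrA -opprD; congr (A - _).
  by rewrite CE trmx_mul !(mulmxBr, mulmxBl) !mulmxA [RHS]addrC subrK.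
(* The sketched normal equation gives [Y^T Y Z Y^T Y = Y^T X E X^T Y]. *)
have ZE : Z = W *m E *m W^T.
  have Mhat_min' : is_argmin (fun M => frobenius_norm
      (X *m A *m X^T - X *m C *m M *m (X *m C)^T)) Mhat.
    move=> M; have := Mhat_min M.
    by rewrite !mulmxBr !mulmxBl trmx_mul !mulmxA.
  have := argmin_normal_eq Mhat_min'.
  have -> : X *m A *m X^T - X *m C *m Mhat *m (X *m C)^T =
      X *m (E - Q *m Z *m Q^T) *m X^T.
    by rewrite -hatE !mulmxBr !mulmxBl trmx_mul !mulmxA.
  have XCE : X *m C = Y *m T by rewrite CE mulmxA YE.
  rewrite XCE trmx_mul => normal.
  have {normal} : Y^T *m (X *m (E - Q *m Z *m Q^T) *m X^T) *m Y = 0.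
    by apply: (congr_unit_eq0 Tu); rewrite -[RHS]normal !mulmxA.
  have YTE : Q^T *m X^T = Y^T by rewrite -trmx_mul YE.
  rewrite (mulmxBr X E) (mulmxBl (X *m E)) (mulmxBr Y^T) (mulmxBl (Y^T *m _)).
  move=> /eqP; rewrite subr_eq0 => /eqP normal.
  have GT : (Y^T *m Y)^T = Y^T *m Y by rewrite trmx_mul trmxK.
  rewrite WE !trmx_mul trmx_inv GT trmxK.
  transitivity (invmx (Y^T *m Y) *m (Y^T *m (X *m E *m X^T) *m Y)
    *m invmx (Y^T *m Y)).
    have XZX : X *m (Q *m Z *m Q^T) *m X^T = Y *m Z *m Y^T.
      by rewrite -YTE -YE !mulmxA.
    rewrite normal XZX.
    have -> : Y^T *m (Y *m Z *m Y^T) *m Y = Y^T *m Y *m (Z *m (Y^T *m Y)).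
      by rewrite !mulmxA.
    by rewrite mulKmx // mulmxK.
  by rewrite !mulmxA.
pose K := Q *m W.
have {ZE}hatE : A - C *m Mhat *m C^T = E - K *m E *m K^T.
  by rewrite hatE ZE /K trmx_mul !mulmxA.
have c0 : 0 <= 1 / sigma_min Y by rewrite div1r invr_ge0 sigma_min_ge0.
split=> [N Nui|].
  have [NN _] := Nui; have [ND NZ _] := NN.
  rewrite hatE -scaleN1r; apply: le_trans (ND _ _) _.
  rewrite NZ normrN1 mul1r mulrDl mul1r lerD2l.
  rewrite -[X in X / _ * _](expr1n _ 2) -expr_div_n.
  exact: uinorm_congr Nui O1O O2O c0 dc KE.
(* Pythagoras: [Q^T *m E *m Q = 0] makes the two terms orthogonal. *)
have orth : mxdot E (K *m E *m K^T) = 0.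
  rewrite /mxdot /K trmx_mul !mulmxA mxtrace_mulC !mulmxA.
  have EQ' : Q^T *m E^T *m Q = 0.
    by apply: trmx_inj; rewrite trmx0 !trmx_mul !trmxK mulmxA EQ.
  by rewrite EQ' !mul0mx mxtrace0.
have := uinorm_congr E (frobenius_uinorm R n) O1O O2O c0 dc KE.
rewrite -/K => fK.
have s4_ge0 : 0 <= 1 / sigma_min Y ^+ 4.
  by rewrite divr_ge0 // exprn_ge0 // sigma_min_ge0.
rewrite hatE -scaleN1r !frobenius_normE -sqrtrM ?addr_ge0 //.
rewrite ler_sqrt ?mulr_ge0 ?addr_ge0 ?mxdot_ge0 //.
rewrite mxdot_add_sqr orth mulr0 addr0 sqrrN expr1n mulrDl !mul1r lerD2l.
move: fK; rewrite -(@ler_pXn2r _ 2) // ?nnegrE;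
  rewrite ?mulr_ge0 ?sqrtr_ge0 ?invr_ge0 ?sigma_min_ge0 //.
rewrite exprMn !frobenius_normE !sqr_sqrtr ?mxdot_ge0 //.
by rewrite -exprM expr_div_n expr1n mul1r.
Qed.
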